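(* Let $k$ be a field. (1) A weakly T-prime ideal of $kS_\infty$ is either prime or equal to $kS_\infty$. (2) Any maximal ideal in $kS_\infty$ is weakly T-prime.
   Context: $S_n$ is the symmetric group on $\{1,\dots,n\}$, $S_n\subset S_{n+1}$ canonically, $S_\infty=\bigcup_nS_n$, $kS_\infty=\bigcup_nkS_n$; ideals are two-sided and $I_n:=I\cap kS_n$. For $f\in kS_m$ and $g\in kS_n$, $f\bullet g\in kS_{m+n}$ denotes the image of $f\otimes g$ under the algebra inclusion $kS_m\otimes kS_n\to kS_{m+n}$ coming from the Young subgroup $S_m\times S_n\subset S_{m+n}$ ($S_m$ permuting $1,\dots,m$ and $S_n$ permuting $m+1,\dots,m+n$). An ideal $I$ of $kS_\infty$ is weakly T-prime if for all $m,n\in\mathbb{Z}_{>0}$, $f\in kS_m$ and $g\in kS_n$ with $f\bullet g\in I_{m+n}$, we have $f\in I$ or $g\in I$. *)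

(* Defs.v *)
From HB Require Import structures.
From mathcomp Require Import all_boot all_algebra all_fingroup.
From mathcomp Require Import finmap boolp classical_sets.
From mathcomp Require Import monalg.

Set Implicit Arguments.
Unset Strict Implicit.
Unset Printing Implicit Defensive.

Import GRing.Theory.

Local Open Scope ring_scope.

(* The carrier of the group algebra is the module {malg R[G]} of finitely
   supported functions G -> R. The ring structure that the library puts on
   {malg R[K]} is not available here: it needs K : monomType, whose axiom
   x * y = 1 -> x = 1 /\ y = 1 excludes nontrivial groups. *)
Section GroupAlgebra.
Context (R : comNzRingType) (G : groupType).

Definition group_algebra : Type := {malg R[G]}.
HB.instance Definition _ := GRing.Lmodule.copy group_algebra {malg R[G]}.

Implicit Types f g h : group_algebra.

Definition ga_one : group_algebra := mkmalgU 1%g 1.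

Definition ga_mul f g : group_algebra :=
  \sum_(x <- msupp f) \sum_(y <- msupp g) mkmalgU (x * y)%g (f@_x * g@_y).

Lemma ga_mulEw (d1 d2 : {fset G}) f g :
  (msupp f `<=` d1)%fset -> (msupp g `<=` d2)%fset ->
  ga_mul f g =
    \sum_(x <- d1) \sum_(y <- d2) mkmalgU (x * y)%g (f@_x * g@_y).
Proof.
move=> le1 le2; rewrite /ga_mul (big_fset_incl _ le1) /=.
  apply/eq_bigr => x _; apply/big_fset_incl => // y _ /mcoeff_outdom ->.
  by rewrite mulr0 monalgU0.
move=> x _ /mcoeff_outdom fx.
by rewrite big1 // => y _; rewrite fx mul0r monalgU0.
Qed.

Lemma ga_mulDl : left_distributive ga_mul +%R.
Proof.
move=> f1 f2 g.
rewrite (ga_mulEw (msuppD_le f1 f2) (fsubset_refl _)).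
rewrite (ga_mulEw (fsubsetUl _ (msupp f2)) (fsubset_refl _)).
rewrite (ga_mulEw (fsubsetUr (msupp f1) _) (fsubset_refl _)).
rewrite -big_split /=; apply/eq_bigr => x _.
rewrite -big_split /=; apply/eq_bigr => y _.
by rewrite mcoeffD mulrDl monalgUD.
Qed.

Lemma ga_mulDr : right_distributive ga_mul +%R.
Proof.
move=> f g1 g2.
rewrite (ga_mulEw (fsubset_refl _) (msuppD_le g1 g2)).
rewrite (ga_mulEw (fsubset_refl _) (fsubsetUl _ (msupp g2))).
rewrite (ga_mulEw (fsubset_refl _) (fsubsetUr (msupp g1) _)).
rewrite -big_split /=; apply/eq_bigr => x _.
rewrite -big_split /=; apply/eq_bigr => y _.
by rewrite mcoeffD mulrDr monalgUD.
Qed.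

Lemma ga_mul0l : left_zero 0 ga_mul.
Proof. by move=> g; apply: (addIr (ga_mul 0 g)); rewrite -ga_mulDl !add0r. Qed.

Lemma ga_mul0r : right_zero 0 ga_mul.
Proof. by move=> g; apply: (addIr (ga_mul g 0)); rewrite -ga_mulDr !add0r. Qed.

Lemma ga_mulUU x y a b :
  ga_mul (mkmalgU x a) (mkmalgU y b) = mkmalgU (x * y)%g (a * b).
Proof. by rewrite (ga_mulEw msuppU_le msuppU_le) !big_seq_fset1 !mcoeffUU. Qed.

Lemma ga_sumE f : f = \sum_(x <- msupp f) (mkmalgU x f@_x : group_algebra).
Proof. exact: monalgE. Qed.

Lemma ga_mul_suml (I : Type) (r : seq I) (F : I -> group_algebra) g :
  ga_mul (\sum_(i <- r) F i) g = \sum_(i <- r) ga_mul (F i) g.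
Proof.
exact: (big_morph (ga_mul^~ g) (fun _ _ => ga_mulDl _ _ _) (ga_mul0l _)).
Qed.

Lemma ga_mul_sumr (I : Type) (r : seq I) (F : I -> group_algebra) f :
  ga_mul f (\sum_(i <- r) F i) = \sum_(i <- r) ga_mul f (F i).
Proof. exact: (big_morph (ga_mul f) (ga_mulDr _) (ga_mul0r _)). Qed.

Lemma ga_mulA : associative ga_mul.
Proof.
move: ga_mul ga_mul_suml ga_mul_sumr ga_mulUU => m mDl mDr mU f g h.
rewrite [f]monalgE [g]monalgE [h]monalgE !mDl; apply/eq_bigr => x _.
rewrite [LHS]mDr [X in _ = m X _]mDr mDl; apply/eq_bigr => y _.
by rewrite !mDr; apply/eq_bigr => z _; rewrite !mU mulrA mulgA.
Qed.

Lemma ga_mul1l : left_id ga_one ga_mul.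
Proof.
move=> f; rewrite [f]monalgE ga_mul_sumr; apply/eq_bigr => x _.
by rewrite ga_mulUU mul1r mul1g.
Qed.

Lemma ga_mul1r : right_id ga_one ga_mul.
Proof.
move=> f; rewrite [f]monalgE ga_mul_suml; apply/eq_bigr => x _.
by rewrite ga_mulUU mulr1 mulg1.
Qed.

Lemma ga_one_neq0 : ga_one != 0.
Proof. by rewrite monalgU_eq0 oner_eq0. Qed.

HB.instance Definition _ := GRing.Zmodule_isNzRing.Build group_algebra
  ga_mulA ga_mul1l ga_mul1r ga_mulDl ga_mulDr ga_one_neq0.

Lemma ga_scaleU (c : R) x a :
  c *: mkmalgU x a = mkmalgU x (c * a) :> group_algebra.
Proof. by apply/malgP => y; rewrite mcoeffZ !mcoeffU mulrnAr. Qed.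

Lemma ga_scalerAl (c : R) f g : c *: (f * g) = c *: f * g.
Proof.
rewrite [f]monalgE [g]monalgE mulr_suml !scaler_sumr mulr_suml.
apply/eq_bigr => x _; rewrite !mulr_sumr scaler_sumr; apply/eq_bigr => y _.
by rewrite ga_scaleU [LHS](congr1 ( *:%R c) (ga_mulUU _ _ _ _)) ga_scaleU
   [RHS]ga_mulUU mulrA.
Qed.

Lemma ga_scalerAr (c : R) f g : c *: (f * g) = f * (c *: g).
Proof.
rewrite [f]monalgE [g]monalgE mulr_suml !scaler_sumr mulr_suml.
apply/eq_bigr => x _; rewrite !mulr_sumr scaler_sumr; apply/eq_bigr => y _.
by rewrite ga_scaleU [LHS](congr1 ( *:%R c) (ga_mulUU _ _ _ _)) ga_scaleU
   [RHS]ga_mulUU mulrCA.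
Qed.

HB.instance Definition _ :=
  GRing.Lmodule_isLalgebra.Build R group_algebra ga_scalerAl.
HB.instance Definition _ :=
  GRing.Lalgebra_isAlgebra.Build R group_algebra ga_scalerAr.

End GroupAlgebra.

Section GroupAlgebraMap.
Context (R : comNzRingType) (G H : groupType) (h : G -> H).

Definition ga_map (f : group_algebra R G) : group_algebra R H :=
  \sum_(x <- msupp f) mkmalgU (h x) f@_x.

Lemma ga_mapEw (d : {fset G}) (f : group_algebra R G) :
  (msupp f `<=` d)%fset -> ga_map f = \sum_(x <- d) mkmalgU (h x) f@_x.
Proof.
move=> le; rewrite /ga_map (big_fset_incl _ le) //= => x _ /mcoeff_outdom ->.
exact: monalgU0.
Qed.

Lemma ga_mapU x a : ga_map (mkmalgU x a) = mkmalgU (h x) a.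
Proof. by rewrite (ga_mapEw msuppU_le) big_seq_fset1 mcoeffUU. Qed.

Lemma ga_map_is_linear : linear ga_map.
Proof.
move=> c f g; have le1 := fsubsetUl (msupp f) (msupp g).
have le2 := fsubsetUr (msupp f) (msupp g).
rewrite (ga_mapEw le1) (ga_mapEw le2) (@ga_mapEw (msupp f `|` msupp g)%fset).
  rewrite scaler_sumr -big_split /=; apply/eq_bigr => x _.
  by rewrite ga_scaleU mcoeffD mcoeffZ monalgUD.
by apply: fsubset_trans (msuppD_le _ _) _; rewrite fsetSU ?msuppZ_le.
Qed.

HB.instance Definition _ := GRing.isLinear.Build R (group_algebra R G)
  (group_algebra R H) *:%R ga_map ga_map_is_linear.

Hypothesis hM : {morph h : x y / (x * y)%g}.

Lemma ga_mapM : {morph ga_map : f g / f * g}.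
Proof.
move=> f g; rewrite [f]monalgE [g]monalgE mulr_suml !raddf_sum mulr_suml.
apply/eq_bigr => x _; rewrite !mulr_sumr raddf_sum; apply/eq_bigr => y _ /=.
by rewrite !ga_mapU [RHS]ga_mulUU -hM -ga_mapU; congr ga_map; exact: ga_mulUU.
Qed.

End GroupAlgebraMap.

(* An injective map nat -> nat with finite support is a permutation moving only
   finitely many points. Points are numbered from 0. *)
Record Sinf : predArgType := MkSinf
  { Sinf_fun :> {fsfun nat -> nat}; _ : fsinjectiveb Sinf_fun }.

HB.instance Definition _ := [isSub for Sinf_fun].
HB.instance Definition _ := [Choice of Sinf by <:].

Section SinfGroup.
Implicit Types s t u : Sinf.

Lemma Sinf_inj s : injective s.
Proof. exact/fsinjectiveP/(valP s). Qed.

Lemma SinfP s t : s =1 t <-> s = t.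
Proof. by split=> [/fsfunP /val_inj|->]. Qed.

Fact Sinf_one_subproof : fsinjectiveb [fsfun for (fun x : nat => x)].
Proof. by apply/fsinjectiveP => x y; rewrite !fsfunE. Qed.

Definition Sinf_one := MkSinf Sinf_one_subproof.

(* As for {perm T}, the left factor acts first. *)
Fact Sinf_mul_subproof s t : fsinjectiveb (fsfun_comp t s).
Proof. by apply/fsinjectiveP/fscomp_inj; exact: Sinf_inj. Qed.

Definition Sinf_mul s t := MkSinf (Sinf_mul_subproof s t).

Definition Sinf_inv_fun s : {fsfun nat -> nat} :=
  [fsfun x in finsupp s => nth x (finsupp s) (index x (map s (finsupp s)))].

Lemma Sinf_inv_funK s : cancel s (Sinf_inv_fun s).
Proof.
move=> x; rewrite fsfunE mem_finsupp (inj_eq (@Sinf_inj s)) -mem_finsupp.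
case: ifPn => [xs|/fsfun_dflt //].
by rewrite (index_map (@Sinf_inj s)) nth_index.
Qed.

Lemma Sinf_fun_invK s : cancel (Sinf_inv_fun s) s.
Proof.
move=> x; have [xs|xNs] := boolP (x \in finsupp s); last first.
  by rewrite [Sinf_inv_fun s x]fsfunE (negbTE xNs) fsfun_dflt.
have /imfsetP[/= y ys ->] : x \in (s @` finsupp s)%fset.
  by have /imfset_eq_fsinjectiveP -> := valP s.
by rewrite Sinf_inv_funK.
Qed.

Fact Sinf_inv_subproof s : fsinjectiveb (Sinf_inv_fun s).
Proof. exact/fsinjectiveP/(can_inj (@Sinf_fun_invK s)). Qed.

Definition Sinf_inv s := MkSinf (Sinf_inv_subproof s).

Lemma Sinf_mulE s t x : Sinf_mul s t x = t (s x).
Proof. exact: fscompE. Qed.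

Lemma Sinf_oneE x : Sinf_one x = x.
Proof. exact: fsfun0E. Qed.

Lemma Sinf_mulA : associative Sinf_mul.
Proof. by move=> s t u; apply/SinfP => x; rewrite !Sinf_mulE. Qed.

Lemma Sinf_mul1s : left_id Sinf_one Sinf_mul.
Proof. by move=> s; apply/SinfP => x; rewrite Sinf_mulE Sinf_oneE. Qed.

Lemma Sinf_muls1 : right_id Sinf_one Sinf_mul.
Proof. by move=> s; apply/SinfP => x; rewrite Sinf_mulE Sinf_oneE. Qed.

Lemma Sinf_mulVs : left_inverse Sinf_one Sinf_inv Sinf_mul.
Proof.
by move=> s; apply/SinfP => x; rewrite Sinf_mulE Sinf_oneE Sinf_fun_invK.
Qed.

Lemma Sinf_mulsV : right_inverse Sinf_one Sinf_inv Sinf_mul.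
Proof.
by move=> s; apply/SinfP => x; rewrite Sinf_mulE Sinf_oneE Sinf_inv_funK.
Qed.

HB.instance Definition _ := isGroup.Build Sinf
  Sinf_mulA Sinf_mul1s Sinf_muls1 Sinf_mulVs Sinf_mulsV.

End SinfGroup.

Section SymIncl.
Context (n : nat).
Implicit Types s t : 'S_n.

Definition nat_of_perm s (x : nat) : nat :=
  if insub x is Some i then nat_of_ord (s i) else x.

Definition sym_incl_fun s : {fsfun nat -> nat} :=
  [fsfun x in [fset x | x in iota 0 n]%fset => nat_of_perm s x].

Lemma sym_incl_funE s : sym_incl_fun s =1 nat_of_perm s.
Proof.
move=> x; rewrite fsfunE !inE mem_iota /= add0n.
by case: ifPn => // xn; rewrite /nat_of_perm insubN.
Qed.

Lemma nat_of_perm_ord s (i : 'I_n) : nat_of_perm s i = s i.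
Proof. by rewrite /nat_of_perm valK. Qed.

Lemma nat_of_perm_out s x : (n <= x)%N -> nat_of_perm s x = x.
Proof. by move=> nx; rewrite /nat_of_perm insubN // -leqNgt. Qed.

Lemma nat_of_permM s t x :
  nat_of_perm (s * t)%g x = nat_of_perm t (nat_of_perm s x).
Proof.
have [xn|nx] := ltnP x n; last by rewrite !nat_of_perm_out.
by rewrite -[x]/(val (Ordinal xn)) !nat_of_perm_ord permM.
Qed.

Fact sym_incl_subproof s : fsinjectiveb (sym_incl_fun s).
Proof.
apply/fsinjectiveP; apply: (can_inj (g := nat_of_perm s^-1)%g) => x.
rewrite sym_incl_funE -nat_of_permM mulgV.
have [xn|nx] := ltnP x n; last by rewrite nat_of_perm_out.
by rewrite -[x]/(val (Ordinal xn)) nat_of_perm_ord perm1.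
Qed.

Definition sym_incl s : Sinf := MkSinf (sym_incl_subproof s).

Lemma sym_inclE s x : sym_incl s x = nat_of_perm s x.
Proof. exact: sym_incl_funE. Qed.

Lemma sym_inclM : {morph sym_incl : s t / (s * t)%g}.
Proof.
by move=> s t; apply/SinfP => x; rewrite Sinf_mulE !sym_inclE nat_of_permM.
Qed.

Lemma sym_incl_inj : injective sym_incl.
Proof.
move=> s t /SinfP st; apply/permP => i; apply/val_inj.
by have := st i; rewrite !sym_inclE !nat_of_perm_ord.
Qed.

End SymIncl.

Lemma sym_incl_onto n (s : Sinf) :
  (forall x, (n <= x)%N -> s x = x) -> exists t : 'S_n, s = sym_incl t.
Proof.
move=> s_fix.
have s_lt (i : 'I_n) : (s i < n)%N.
  rewrite ltnNge; apply/negP => le_n.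
  have /Sinf_inj si : s (s i) = s i by rewrite s_fix.
  by move: le_n; rewrite si leqNgt ltn_ord.
have f_inj : injective (fun i => Ordinal (s_lt i)).
  by move=> i j /(congr1 val) /= /Sinf_inj /val_inj.
exists (perm f_inj); apply/SinfP => x; rewrite sym_inclE.
have [xn|nx] := ltnP x n; last by rewrite nat_of_perm_out ?s_fix.
by rewrite -[x]/(val (Ordinal xn)) nat_of_perm_ord permE.
Qed.

Section Young.
Context (m n : nat).
Implicit Types (s : 'S_m) (t : 'S_n).

Definition young_fun s t (i : 'I_(m + n)) : 'I_(m + n) :=
  match fintype.split i with
  | inl a => lshift n (s a)
  | inr b => rshift m (t b)
  end.

Fact young_fun_inj s t : injective (young_fun s t).
Proof.
have young_funE u : young_fun s t (unsplit u) =
    unsplit (match u with inl a => inl (s a) | inr b => inr (t b) end).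
  by rewrite /young_fun unsplitK; case: u.
move=> i j; rewrite -[i]splitK -[j]splitK !young_funE.
move=> /(can_inj (@unsplitK _ _)).
by case: (fintype.split i) (fintype.split j) => [a|b] [c|d] // [] /perm_inj ->.
Qed.

Definition young s t : 'S_(m + n) := perm (@young_fun_inj s t).

Lemma young_lshift s t a : young s t (lshift n a) = lshift n (s a).
Proof. by rewrite permE /young_fun (unsplitK (inl a)). Qed.

Lemma young_rshift s t b : young s t (rshift m b) = rshift m (t b).
Proof. by rewrite permE /young_fun (unsplitK (inr b)). Qed.

Lemma youngM s1 s2 t1 t2 :
  young (s1 * s2)%g (t1 * t2)%g = (young s1 t1 * young s2 t2)%g.
Proof.
apply/permP => i; rewrite permM; case: (split_ordP i) => j ->.
  by rewrite !young_lshift permM.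
by rewrite !young_rshift permM.
Qed.

End Young.

Notation kS k n := (group_algebra k 'S_n).
Notation kSinf k := (group_algebra k Sinf).

Section SymmetricGroupAlgebras.
Context (k : fieldType).

Definition kS_incl (n : nat) : kS k n -> kSinf k := ga_map (@sym_incl n).

Lemma kS_inclM n : {morph @kS_incl n : f g / f * g}.
Proof. exact/ga_mapM/sym_inclM. Qed.

Lemma kSinf_union (f : kSinf k) : exists n (g : kS k n), f = kS_incl g.
Proof.
have [n s_lt] : exists n, forall s x,
    s \in msupp f -> x \in finsupp s -> (x < n)%N.
  exists (\max_(s <- msupp f) \max_(x <- finsupp (Sinf_fun s)) x.+1).
  move=> s x sf xs.
  apply: leq_trans (leq_bigmax_seq _ sf isT).
  exact: (leq_bigmax_seq (F := succn) x xs).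
pose pull (s : Sinf) : 'S_n := odflt 1%g [pick t | s == sym_incl t].
exists n, (\sum_(s <- msupp f) (mkmalgU (pull s) f@_s : kS k n)).
rewrite [LHS]ga_sumE /kS_incl raddf_sum; apply: eq_big_seq => s sf /=.
rewrite ga_mapU; suff -> : sym_incl (pull s) = s by [].
rewrite /pull.
case: pickP => [t /eqP //|no_t].
have [x nx|t st] := @sym_incl_onto n s; last by have := no_t t; rewrite st eqxx.
by apply: fsfun_dflt; apply: contraTN nx => /(s_lt _ _ sf); rewrite -ltnNge.
Qed.

Definition bullet (m n : nat) (f : kS k m) (g : kS k n) : kS k (m + n) :=
  \sum_(s : 'S_m) \sum_(t : 'S_n) mkmalgU (young s t) (f@_s * g@_t).

End SymmetricGroupAlgebras.

Local Open Scope classical_set_scope.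

Section TwoSidedIdeals.
Context (R : nzRingType).
Implicit Types I J P M : set R.

Record two_sided_ideal I : Prop := TwoSidedIdeal {
  ts_ideal0 : I 0;
  ts_idealD : forall x y, I x -> I y -> I (x + y);
  ts_idealMl : forall a x, I x -> I (a * x);
  ts_idealMr : forall a x, I x -> I (x * a)
}.

Definition ideal_mul I J : set R :=
  [set x | exists2 s : seq (R * R),
    forall p, p \in s -> I p.1 /\ J p.2 & x = \sum_(p <- s) p.1 * p.2].

(* Primeness in the noncommutative sense: a condition on ideals, not on
   elements. *)
Definition ts_prime P : Prop :=
  [/\ two_sided_ideal P, P <> setT &
     forall I J, two_sided_ideal I -> two_sided_ideal J ->
       ideal_mul I J `<=` P -> I `<=` P \/ J `<=` P].

Definition ts_maximal M : Prop :=
  [/\ two_sided_ideal M, M <> setT &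
     forall J, two_sided_ideal J -> M `<=` J -> J = M \/ J = setT].

End TwoSidedIdeals.

Section WeaklyTPrime.
Context (k : fieldType).

(* I_n = I :&: kS_n, as a subset of kS_n. *)
Definition ideal_trunc (I : set (kSinf k)) (n : nat) : set (kS k n) :=
  @kS_incl k n @^-1` I.

Definition weakly_Tprime (I : set (kSinf k)) : Prop :=
  two_sided_ideal I /\
  forall m n : nat, (0 < m)%N -> (0 < n)%N -> forall (f : kS k m) (g : kS k n),
    ideal_trunc I (bullet f g) -> I (kS_incl f) \/ I (kS_incl g).

End WeaklyTPrime.

(* Main.v *)
Require Import Defs.
From mathcomp Require Import all_boot all_algebra all_fingroup.
From mathcomp Require Import finmap boolp monalg zify.
From mathcomp Require Import classical_sets.

(** Write [block_incl p] for the map placing kS_n on the points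
    p, ..., p + n - 1. All these copies of kS_n are conjugate in kSinf, by
    products of permutations that exchange two disjoint blocks of points; so a two-sided
    ideal that contains one placement of g contains all of them
    ([block_incl_ideal]). Moreover f . g is the product of f, placed on
    0, ..., m - 1, by g placed at m ([kS_incl_bullet]).

    (1) Suppose that the product of the ideals I and J lies in P, and that f in I
    is not in P. For g in J, the copy of g placed at m is in J too, so f . g
    lies in I J, hence in P, and weak T-primeness puts g in P.

    (2) Let M be maximal with f . g in M. Consider the set of all x such that
    x g' is in M for every copy g' of g placed far enough
    ([far_annihilator]). It is a left ideal, and also a right
    one since any given a in kSinf moves finitely many points, thus commutes with
    far copies of g. It contains M; it also contains f, because f g' is
    a conjugate of f . g for far g'. By maximality it is M, and then f is in M,
    or it is everything, and then x = 1 shows that a copy of g, hence g, is in M. *)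

Set Implicit Arguments.
Unset Strict Implicit.
Unset Printing Implicit Defensive.

Import GRing.Theory.

Local Open Scope ring_scope.
Local Open Scope classical_set_scope.

(** * Group elements acting on images of group algebras *)

Section GroupElements.
Context (R : comNzRingType).

Definition ga_elt (G : groupType) (x : G) : group_algebra R G := mkmalgU x 1.

Lemma ga_eltM (G : groupType) (x y : G) :
  ga_elt x * ga_elt y = ga_elt (x * y)%g.
Proof. by rewrite [LHS]ga_mulUU mulr1. Qed.

Lemma ga_eltVK (G : groupType) (x : G) : ga_elt x^-1%g * ga_elt x = 1.
Proof. by rewrite ga_eltM mulVg. Qed.

Lemma ga_eltKV (G : groupType) (x : G) : ga_elt x * ga_elt x^-1%g = 1.
Proof. by rewrite ga_eltM mulgV. Qed.

Lemma ga_mapE (G H : groupType) (h : G -> H) (f : group_algebra R G) :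
  ga_map h f = \sum_(x <- msupp f) f@_x *: ga_elt (h x).
Proof. by apply: eq_bigr => x _; rewrite ga_scaleU mulr1. Qed.

Lemma ga_map_sum_fin (G : finGroupType) (H : groupType) (h : G -> H)
    (f : group_algebra R G) :
  ga_map h f = \sum_(x : G) f@_x *: ga_elt (h x).
Proof.
have fE : f = \sum_(x : G) f@_x *: ga_elt x.
  apply/malgP => y; rewrite raddf_sum (bigD1 y) //= big1 => [|x xy].
    by rewrite addr0 mcoeffZ mcoeffUU mulr1.
  by rewrite mcoeffZ mcoeffU (negbTE xy) mulr0.
rewrite {1}fE raddf_sum; apply: eq_bigr => x _.
by rewrite !ga_scaleU !mulr1; exact: ga_mapU.
Qed.

Lemma eq_ga_map (G H : groupType) (h h' : G -> H) (f : group_algebra R G) :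
  h =1 h' -> ga_map h f = ga_map h' f.
Proof. by move=> eq_h; apply: eq_bigr => x _; rewrite eq_h. Qed.

(** Both sides are linear in f, so the conjugation identity between h and h' only
    has to be known on group elements. *)
Lemma ga_map_intertwine (G H : groupType) (h h' : G -> H) (d : H)
    (f : group_algebra R G) :
  (forall x, h x * d = d * h' x)%g ->
  ga_map h f * ga_elt d = ga_elt d * ga_map h' f.
Proof.
move=> hd; rewrite !ga_mapE mulr_suml mulr_sumr; apply: eq_bigr => x _.
by rewrite -scalerAl -scalerAr !ga_eltM hd.
Qed.

Lemma ga_map_comm (G G' H : groupType) (h : G -> H) (h' : G' -> H)
    (f : group_algebra R G) (g : group_algebra R G') :
  (forall x y, commute (h x) (h' y)) ->
  ga_map h f * ga_map h' g = ga_map h' g * ga_map h f.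
Proof.
move=> hh'; rewrite [ga_map h' g]ga_mapE mulr_sumr mulr_suml.
apply: eq_bigr => y _; rewrite -scalerAr -scalerAl; congr (_ *: _).
by apply: ga_map_intertwine => x; apply: hh'.
Qed.

(** The hypothesis says that y is the conjugate of x by the unit d; it is
    inverse-free because that is the form [ga_map_intertwine] produces. *)
Lemma ts_ideal_conj (G : groupType) (I : set (group_algebra R G)) d x y :
  two_sided_ideal I -> x * ga_elt d = ga_elt d * y -> I x <-> I y.
Proof.
move=> tsI xd; split=> [Ix|Iy].
  have -> : y = ga_elt d^-1%g * (x * ga_elt d).
    by rewrite xd mulrA ga_eltVK mul1r.
  by apply: (ts_idealMl tsI); apply: (ts_idealMr tsI).
have -> : x = ga_elt d * y * ga_elt d^-1%g.
  by rewrite -xd -mulrA ga_eltKV mulr1.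
by apply: (ts_idealMr tsI); apply: (ts_idealMl tsI).
Qed.

End GroupElements.

(** * Blocks of points *)

Lemma nat_of_perm_lt n (t : 'S_n) x : (nat_of_perm t x < n)%N = (x < n)%N.
Proof.
have [xn|nx] := ltnP x n; last by rewrite nat_of_perm_out // ltnNge nx.
by rewrite -[x]/(val (Ordinal xn)) nat_of_perm_ord ltn_ord.
Qed.

Definition sym_block n p (t : 'S_n) : Sinf := sym_incl (young (1%g : 'S_p) t).

Lemma nat_of_perm_young m n (s : 'S_m) (t : 'S_n) x :
  nat_of_perm (young s t) x =
    if (x < m)%N then nat_of_perm s x else (m + nat_of_perm t (x - m))%N.
Proof.
have [xmn|mnx] := ltnP x (m + n); last first.
  by rewrite nat_of_perm_out // ifN ?nat_of_perm_out; lia.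
rewrite -[x]/(val (Ordinal xmn)); case: (split_ordP (Ordinal xmn)) => j ->.
  by rewrite nat_of_perm_ord young_lshift /= nat_of_perm_ord.
by rewrite nat_of_perm_ord young_rshift /= addKn nat_of_perm_ord.
Qed.

Lemma nat_of_perm1 n x : nat_of_perm (1%g : 'S_n) x = x.
Proof.
have [xn|nx] := ltnP x n; last by rewrite nat_of_perm_out.
by rewrite -[x]/(val (Ordinal xn)) nat_of_perm_ord perm1.
Qed.

Lemma sym_blockE n p (t : 'S_n) x :
  sym_block p t x = if (x < p)%N then x else (p + nat_of_perm t (x - p))%N.
Proof. by rewrite sym_inclE nat_of_perm_young nat_of_perm1. Qed.

Lemma sym_block0 n (t : 'S_n) : sym_block 0 t = sym_incl t.
Proof. by apply/SinfP => x; rewrite sym_blockE sym_inclE subn0. Qed.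

(** A Young permutation is the product of two permutations with disjoint
    supports; this is the group-level form of [kS_incl_bullet]. *)
Lemma sym_incl_young m n (s : 'S_m) (t : 'S_n) :
  sym_incl (young s t) = (sym_incl s * sym_block m t)%g.
Proof.
apply/SinfP => x; rewrite Sinf_mulE sym_blockE !sym_inclE nat_of_perm_young.
rewrite nat_of_perm_lt; case: ifPn => // mx.
by rewrite (nat_of_perm_out s) // leqNgt.
Qed.

Lemma sym_block_comm m n p (s : 'S_m) (t : 'S_n) :
  (m <= p)%N -> commute (sym_incl s) (sym_block p t).
Proof.
move=> mp; apply/SinfP => x; rewrite !Sinf_mulE !sym_blockE !sym_inclE.
have [xp|px] := ltnP x p; last first.
  by rewrite !(nat_of_perm_out s) ?ifN //; lia.
rewrite ifT //; have := nat_of_perm_lt s x.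
have [xm|mx] := ltnP x m; first lia.
by rewrite nat_of_perm_out.
Qed.

Lemma Sinf_of_involution N (D : nat -> nat) :
  involutive D -> (forall x, (N <= x)%N -> D x = x) ->
  exists d : Sinf, d =1 D.
Proof.
move=> DK DN; pose d : {fsfun nat -> nat} :=
  [fsfun x in [fset x | x in iota 0 N]%fset => D x].
have dE : d =1 D.
  move=> x; rewrite fsfunE !inE mem_iota /= add0n.
  by case: ifPn => // Nx; rewrite DN // leqNgt.
have d_inj : fsinjectiveb d.
  by apply/fsinjectiveP; apply: (can_inj (g := D)) => x; rewrite dE DK.
by exists (MkSinf d_inj).
Qed.

(** The permutation d swaps the disjoint blocks starting at p and q, point by
    point. It conjugates the action of 'S_n on one block into the action on the
    other, and commutes with 'S_p because it moves no point below p. *)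
Lemma block_exchange n p q : (p + n <= q)%N ->
  exists2 d : Sinf,
    forall t : 'S_n, (sym_block p t * d = d * sym_block q t)%g &
    forall s : 'S_p, (sym_incl s * d = d * sym_incl s)%g.
Proof.
move=> pnq; pose D x := if (p <= x < p + n)%N then (x - p + q)%N else
  if (q <= x < q + n)%N then (x - q + p)%N else x.
have D1 x : (p <= x < p + n)%N -> D x = (x - p + q)%N by rewrite /D => ->.
have D2 x : (q <= x < q + n)%N -> D x = (x - q + p)%N.
  by move=> xq; rewrite /D xq ifN //; lia.
have D3 x : ~~ (p <= x < p + n)%N -> ~~ (q <= x < q + n)%N -> D x = x.
  by move=> xp xq; rewrite /D !ifN.
have DK : involutive D.
  move=> x; have [xp|xp] := boolP (p <= x < p + n)%N.
    by rewrite (D1 x) // D2; lia.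
  have [xq|xq] := boolP (q <= x < q + n)%N; last by rewrite !D3.
  by rewrite (D2 x) // D1; lia.
have [|d dE] := Sinf_of_involution (N := (q + n)%N) DK.
  by move=> x qnx; apply: D3; lia.
exists d => [t|s]; apply/SinfP => x; rewrite !Sinf_mulE !dE; last first.
  rewrite !sym_inclE; have := nat_of_perm_lt s x.
  have [xp sp|px _] := ltnP x p; first by rewrite !D3 //; lia.
  rewrite !(nat_of_perm_out s) //.
  have [xp|xp] := boolP (p <= x < p + n)%N; first by rewrite D1; lia.
  have [xq|xq] := boolP (q <= x < q + n)%N; first by rewrite D2; lia.
  by rewrite D3.
rewrite !sym_blockE; have [xp|px] := ltnP x p.
  by rewrite D3 ?ifT //; lia.
(* The points from p on: those of the block at p are carried to the block at q
   before or after t acts; the others are fixed by t on both sides. *)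
have := nat_of_perm_lt t (x - p).
have [xn tx|nx _] := ltnP (x - p) n.
  rewrite (D1 x) ?D1 ?ifN; try lia.
  by rewrite addnK addnC addKn.
rewrite nat_of_perm_out // subnKC //.
have [xq|xq] := boolP (q <= x < q + n)%N; first by rewrite D2 // ifT //; lia.
by rewrite D3; [|lia|lia]; case: ifPn => // qx; rewrite nat_of_perm_out; lia.
Qed.

(** * Copies of g in the infinite symmetric group algebra *)

Section BlockIncl.
Context (k : fieldType).

Definition block_incl n p (g : kS k n) : kSinf k := ga_map (sym_block p) g.

Lemma block_incl0 n (g : kS k n) : block_incl 0 g = kS_incl g.
Proof. exact/eq_ga_map/sym_block0. Qed.

Lemma block_incl_comm m n p (f : kS k m) (g : kS k n) : (m <= p)%N ->
  kS_incl f * block_incl p g = block_incl p g * kS_incl f.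
Proof. by move=> mp; apply: ga_map_comm => s t; apply: sym_block_comm. Qed.

Lemma kS_incl_bullet m n (f : kS k m) (g : kS k n) :
  kS_incl (bullet f g) = kS_incl f * block_incl m g.
Proof.
rewrite [kS_incl f]ga_map_sum_fin [block_incl m g]ga_map_sum_fin.
rewrite /kS_incl raddf_sum mulr_suml.
apply: eq_bigr => s _; rewrite raddf_sum mulr_sumr; apply: eq_bigr => t _ /=.
rewrite ga_mapU sym_incl_young -scalerAl -scalerAr ga_eltM scalerA.
by rewrite ga_scaleU mulr1.
Qed.

(** Weak T-primeness only speaks of groups on at least one point; multiplying by
    the identity of 'S_1 with [bullet] adds one more point to be fixed. *)
Lemma kSinf_union_pos (x : kSinf k) :
  exists n (g : kS k n), (0 < n)%N /\ x = kS_incl g.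
Proof.
have [n [g ->]] := kSinf_union x.
exists (n + 1)%N, (bullet g (ga_elt k (1%g : 'S_1))).
split; first by rewrite addn1.
rewrite kS_incl_bullet.
have -> : block_incl n (ga_elt k (1%g : 'S_1)) =
    ga_elt k (sym_block n (1%g : 'S_1)).
  exact: ga_mapU.
have -> : sym_block n (1%g : 'S_1) = 1%g.
  apply/SinfP => y; rewrite sym_blockE nat_of_perm1 Sinf_oneE.
  by case: ltnP => // /subnKC.
by rewrite -[ga_elt k _]/(1 : kSinf k) mulr1.
Qed.

(** Conjugating by the exchange of the blocks at p and q leaves f alone and
    moves g, so the two products are conjugate. *)
Lemma block_incl_far n p q (g : kS k n) (I : set (kSinf k)) (f : kS k p) :
  two_sided_ideal I -> (p + n <= q)%N ->
  I (kS_incl f * block_incl p g) <-> I (kS_incl f * block_incl q g).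
Proof.
move=> tsI /block_exchange[d dt ds]; apply: (ts_ideal_conj (d := d) tsI).
by rewrite -mulrA (ga_map_intertwine _ dt) mulrA (ga_map_intertwine _ ds) mulrA.
Qed.

(** The blocks at 0 and at p may overlap, so they are compared through the block
    at p + n, which is disjoint from both. *)
Lemma block_incl_ideal n p (g : kS k n) (I : set (kSinf k)) :
  two_sided_ideal I -> I (block_incl p g) <-> I (kS_incl g).
Proof.
move=> tsI; have far r : (r + n <= p + n)%N ->
    I (block_incl r g) <-> I (block_incl (p + n) g).
  move=> /block_exchange[d dt _]; apply: (ts_ideal_conj (d := d) tsI).
  exact: ga_map_intertwine.
have := far 0%N; rewrite block_incl0 add0n => /(_ (leq_addl _ _)) far0.
exact: (iff_trans (far p (leqnn _)) (iff_sym far0)).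
Qed.

(** The threshold N may depend on x: this is what makes the set stable under right
    multiplication by elements moving arbitrarily many points. *)
Definition far_annihilator n (g : kS k n) (M : set (kSinf k)) : set (kSinf k) :=
  [set x | exists N, forall p, (N <= p)%N -> M (x * block_incl p g)].

Lemma far_annihilator_ideal n (g : kS k n) (M : set (kSinf k)) :
  two_sided_ideal M -> two_sided_ideal (far_annihilator g M).
Proof.
move=> tsM; split=> [|x y [N1 M1] [N2 M2]|a x [N Mx]|a x [N Mx]].
- by exists 0%N => p _; rewrite mul0r; apply: ts_ideal0 tsM.
- exists (maxn N1 N2) => p; rewrite geq_max => /andP[N1p N2p].
  by rewrite mulrDl; apply: ts_idealD tsM _ _ _ _; [apply: M1|apply: M2].
- by exists N => p Np; rewrite -mulrA; apply: (ts_idealMl tsM); apply: Mx.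
have [m [a' ->]] := kSinf_union a.
exists (maxn N m) => p; rewrite geq_max => /andP[Np mp].
rewrite -mulrA block_incl_comm // mulrA.
by apply: (ts_idealMr tsM); apply: Mx.
Qed.

Lemma weakly_Tprime_prime (P : set (kSinf k)) :
  weakly_Tprime P -> P <> setT -> ts_prime P.
Proof.
move=> [tsP wP] PnT; split=> // I J tsI tsJ IJP.
have [|/existsNP[x /not_implyP[Ix nPx]]] := EM (I `<=` P); first by left.
right=> y; have [m [f [m0 xE]]] := kSinf_union_pos x.
have [n [g [n0 ->]]] := kSinf_union_pos y.
move=> Jg; have [] // := wP m n m0 n0 f g; last by rewrite -xE.
apply: IJP; rewrite kS_incl_bullet.
exists [:: (kS_incl f, block_incl m g)]; last by rewrite big_seq1.
move=> _ /[!inE] /eqP -> /=; split; first by rewrite -xE.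
exact/block_incl_ideal.
Qed.

Lemma maximal_weakly_Tprime (M : set (kSinf k)) :
  ts_maximal M -> weakly_Tprime M.
Proof.
move=> [tsM _ maxM]; split=> // m n _ _ f g.
rewrite /ideal_trunc /preimage /= kS_incl_bullet => Mfg.
have [|AM|AT] := maxM _ (far_annihilator_ideal g tsM).
- by move=> x Mx; exists 0%N => p _; apply: ts_idealMr.
- left; rewrite -AM; exists (m + n)%N => p mnp.
  have [MfgP _] := block_incl_far g f tsM mnp.
  exact: MfgP Mfg.
right; have [N Mg] : far_annihilator g M 1 by rewrite AT.
have [MgP _] := block_incl_ideal N g tsM.
by apply: MgP; rewrite -[block_incl N g]mul1r; apply: Mg.
Qed.

End BlockIncl.

Theorem proposition2p1p4 (k : fieldType) :
  (forall I : set (kSinf k), weakly_Tprime I -> ts_prime I \/ I = setT) /\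
  (forall I : set (kSinf k), ts_maximal I -> weakly_Tprime I).
Proof.
split=> [I wI|I]; last exact: maximal_weakly_Tprime.
have [|InT] := EM (I = setT); first by right.
by left; apply: weakly_Tprime_prime.
Qed.
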